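(* Fix $m\in\mathbb Z^+$, $\gamma\in\Delta_m$, $W_0\in\mathcal B^\gamma$, a continuous graph parameter $\tau$, and let $t\in\mathbb R$. If $\phi_\tau(W_0,\cdot)$ is continuous at $t$, then $$\phi_\tau(W_0,t)=\inf\{I_{W_0}(f):f\in\mathcal W,\ \tau(f)\ge t\}.$$
   Context: A graphon is a measurable symmetric function $f:[0,1]^2\to[0,1]$; $\mathcal W$ is the set of graphons. $d_\square(f,g)=\sup_{S,T\subseteq[0,1]}\left|\int_{S\times T}(f-g)\right|$ over measurable $S,T$; $\delta_\square(f,g)=\inf_{\phi}d_\square(f,g^\phi)$ over bijective Lebesgue-measure-preserving $\phi:[0,1]\to[0,1]$, where $g^\phi(x,y)=g(\phi(x),\phi(y))$. $\tilde f$ is the class of $f$ under $f\sim g\iff\delta_\square(f,g)=0$, and $\tilde{\mathcal W}=\mathcal W/\!\sim$ with metric $\delta_\square$ (a compact metric space). $\Delta_m=\{\gamma\in[0,1]^m\cap\mathbb Q^m:\sum_i\gamma_i=1\}$; for $\gamma\in\Delta_m$ let $I_1=[0,\gamma_1]$, $I_j=(\sum_{k<j}\gamma_k,\sum_{k\le j}\gamma_k]$ for $j\ge2$, and $\mathcal B^\gamma$ is the set of graphons constant on each $I_i\times I_j$ (with values $p_{ij}=p_{ji}\in[0,1]$). $h_p(u)=u\log\frac up+(1-u)\log\frac{1-u}{1-p}$ (with $0\log0=0$, $0\log(0/0)=0$, value $+\infty$ if $p\in\{0,1\}$, $u\ne p$); $I_{W_0}(f)=\frac12\int_{[0,1]^2}h_{W_0(x,y)}(f(x,y))\,dx\,dy$;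 $\Omega=\{W_0\in(0,1)\}$; $\mathcal W_\Omega$ is the set of graphons equal to $W_0$ a.e. on $\Omega^c$; $\tilde{\mathcal W}_\Omega$ is the set of classes $\tilde f$ with $\delta_\square(\tilde f,g)=0$ for some $g\in\mathcal W_\Omega$. $J_{W_0}(\tilde f)=\sup_{\eta>0}\inf\{I_{W_0}(h):h\in\mathcal W,\delta_\square(\tilde f,h)\le\eta\}$ if $\tilde f\in\tilde{\mathcal W}_\Omega$ and $\infty$ otherwise. A continuous graph parameter is a function $\tau:\tilde{\mathcal W}\to\mathbb R$ continuous with respect to $\delta_\square$; $\tau(f)=\tau(\tilde f)$ for $f\in\mathcal W$. $\phi_\tau(W_0,t)=\min\{J_{W_0}(\tilde f):\tilde f\in\tilde{\mathcal W},\tau(\tilde f)\ge t\}$ for $t\le\max_{\tilde{\mathcal W}}\tau$, and $\phi_\tau(W_0,t)=\infty$ for $t>\max_{\tilde{\mathcal W}}\tau$. The infimum over the empty set is $\infty$. *)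

(* Defs.v *)
From HB Require Import structures.
From mathcomp Require Import all_boot all_order all_algebra.
From mathcomp Require Import all_classical all_reals all_analysis.

Set Implicit Arguments.
Unset Strict Implicit.
Unset Printing Implicit Defensive.

Import Order.TTheory GRing.Theory Num.Theory.
Import numFieldNormedType.Exports.

Local Open Scope classical_set_scope.
Local Open Scope ring_scope.

(* Throughout, [0,1] is the subset `[0, 1] of R and
   "measurable" is Borel measurable.  Functions on [0,1] or [0,1]^2 are total
   functions on R or R * R whose values off the domain play no role: every
   condition, integral and supremum below is restricted to the domain. *)

Definition unit_itv (R : realType) : set R := `[0, 1].
Definition unit_square (R : realType) : set (R * R) :=
  @unit_itv R `*` @unit_itv R.

Definition lebesgue2 (R : realType) :
  {measure set (measurableTypeR R * measurableTypeR R) -> \bar R} :=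
  ((@lebesgue_measure R) \x (@lebesgue_measure R))%E.

Record graphon (R : realType) := Graphon {
  graphon_fun :> R * R -> R;
  graphon_measurable : measurable_fun (@unit_square R) graphon_fun;
  graphon_sym : forall x y : R, unit_square (x, y) ->
    graphon_fun (x, y) = graphon_fun (y, x);
  graphon_range : forall z : R * R, unit_square z ->
    0 <= graphon_fun z <= 1
}.

Definition d_cut (R : realType) (f g : R * R -> R) : \bar R :=
  ereal_sup [set e | exists S T : set R,
    [/\ measurable S, measurable T, S `<=` @unit_itv R, T `<=` @unit_itv R
      & e = `| \int[@lebesgue2 R]_(z in S `*` T) (f z - g z)%:E |%E]].

Definition measure_preserving_bijection (R : realType) (phi : R -> R) : Prop :=
  [/\ set_bij (@unit_itv R) (@unit_itv R) phi,
      measurable_fun (@unit_itv R) phi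
    & forall A : set R, measurable A -> A `<=` @unit_itv R ->
        lebesgue_measure (@unit_itv R `&` phi @^-1` A) = lebesgue_measure A].

Definition relabel (R : realType) (g : R * R -> R) (phi : R -> R) :
  R * R -> R := fun z => g (phi z.1, phi z.2).

Definition delta_cut (R : realType) (f g : graphon R) : \bar R :=
  ereal_inf [set d_cut f (relabel g phi) |
    phi in @measure_preserving_bijection R].

(* The quotient of the graphons by delta_cut f g = 0: its points are the
   equivalence classes themselves. *)
Record graphon_class (R : realType) := GraphonClass {
  class_members :> set (graphon R);
  class_membersP : exists f : graphon R,
    class_members = [set g | delta_cut f g = 0%E]
}.

Definition class_of (R : realType) (f : graphon R) : graphon_class R :=
  GraphonClass (ex_intro _ f erefl).

(* The metric on classes.  delta_cut is a pseudometric, so it takes the same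
   value on all pairs of representatives; the infimum over representatives
   is a choice-free way to name this common value. *)
Definition delta_class (R : realType) (c c' : graphon_class R) : \bar R :=
  ereal_inf [set e | exists f g : graphon R,
    [/\ class_members c f, class_members c' g & e = delta_cut f g]].

Definition simplexQ (m : nat) : set ('I_m -> rat) :=
  [set gamma | (forall i, 0 <= gamma i <= 1) /\ \sum_i gamma i = 1].

Definition block (R : realType) (m : nat) (gamma : 'I_m -> rat) (j : 'I_m) :
  set R :=
  let a : R := ratr (\sum_(k < m | (k < j)%N) gamma k) in
  let b : R := ratr (\sum_(k < m | (k <= j)%N) gamma k) in
  if j == 0%N :> nat then `[a, b]%classic else `]a, b]%classic.

Definition block_graphons (R : realType) (m : nat) (gamma : 'I_m -> rat) :
  set (graphon R) :=
  [set f | exists p : 'I_m -> 'I_m -> R,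
    [/\ forall i j, p i j = p j i, forall i j, 0 <= p i j <= 1
      & forall i j x y, block gamma i x -> block gamma j y ->
          f (x, y) = p i j]].

(* In the last branch the conventions 0 log 0 = 0 and 0 log (0/0) = 0 hold
   because ln and the inverse are total functions. *)
Definition rel_entropy (R : realType) (p u : R) : \bar R :=
  if ((p == 0) || (p == 1)) && (u != p) then +oo%E
  else (u * ln (u / p) + (1 - u) * ln ((1 - u) / (1 - p)))%:E.

Definition rate_I (R : realType) (W0 f : graphon R) : \bar R :=
  ((2^-1)%:E *
   \int[@lebesgue2 R]_(z in @unit_square R) rel_entropy (W0 z) (f z))%E.

Definition Omega (R : realType) (W0 : graphon R) : set (R * R) :=
  [set z | unit_square z /\ 0 < W0 z < 1].

Definition graphons_Omega (R : realType) (W0 : graphon R) :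
  set (graphon R) :=
  [set f | {ae @lebesgue2 R, forall z,
    (@unit_square R `\` Omega W0) z -> f z = W0 z}].

Definition classes_Omega (R : realType) (W0 : graphon R) :
  set (graphon_class R) :=
  [set c | exists2 g, graphons_Omega W0 g & delta_class c (class_of g) = 0%E].

Definition rate_J (R : realType) (W0 : graphon R) (c : graphon_class R) :
  \bar R :=
  if `[< classes_Omega W0 c >] then
    ereal_sup [set ereal_inf [set rate_I W0 h |
        h in [set h : graphon R | (delta_class c (class_of h) <= eta%:E)%E]] |
      eta in [set eta : R | 0 < eta]]
  else +oo%E.

Definition continuous_graph_parameter (R : realType)
  (tau : graphon_class R -> R) : Prop :=
  forall (c : graphon_class R) (eps : R), 0 < eps ->
    exists2 r : R, 0 < r & forall c' : graphon_class R,
      (delta_class c c' < r%:E)%E -> `|tau c' - tau c| < eps.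

(* When t exceeds the maximum of tau the set is empty, and ereal_inf set0 is
   +oo; otherwise it is the minimum, attained because the space of classes
   is compact and rate_J lower semicontinuous. *)
Definition phi_param (R : realType) (tau : graphon_class R -> R)
  (W0 : graphon R) (t : R) : \bar R :=
  ereal_inf [set rate_J W0 c | c in [set c : graphon_class R | t <= tau c]].

(* Main.v *)
Require Import Defs.
From mathcomp Require Import all_boot all_order all_algebra.
From mathcomp Require Import all_classical all_reals all_analysis.
From mathcomp Require Import lra.
Import Order.TTheory GRing.Theory Num.Theory.
Import numFieldNormedType.Exports.
Local Open Scope classical_set_scope.
Local Open Scope ring_scope.

(** Write I for [rate_I W0], J for [rate_J W0], phi for [phi_param tau W0] and
    inf_t for the infimum of I over the graphons f with tau f >= t; the theorem
    is phi t = inf_t.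

    For phi t <= inf_t it suffices that J (class f) <= I f for each graphon f
    ([rate_J_class_of_le]).  J at the class of f is a supremum over eta of
    infima of I over the eta-ball around f, and each ball contains f; what
    remains is the case in which that class is excluded from the domain of J.
    If I f is finite then f = W0 almost everywhere on the set where W0 is 0
    or 1, because the relative entropy of numbers in [0, 1] is nonnegative, and
    it is infinite where f differs from such a value of W0
    ([rate_I_lty_graphons_Omega]).  So an excluded class has I f = +oo.

    For inf_t <= phi t, let s > t and let c be a class with tau c >= s.  By
    continuity of tau, all graphons in a small enough ball around c have
    tau >= t, so the infimum of I over this ball, which is at most J c, is at
    least inf_t ([inf_rate_I_le_rate_J]).  Hence inf_t <= phi s for each s > t.
    The strict inequality s > t is what leaves room for the ball, and the
    continuity of phi at t removes it by letting s decrease to t. *)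

(** * Nonnegativity of the relative entropy *)

(** For u > 0 this is ln x <= x - 1 at x = p / u, multiplied by u.
    The relative entropy of u with respect to p is the sum of two such terms,
    for (p, u) and (1 - p, 1 - u), whose lower bounds u - p and p - u cancel. *)
Lemma mulr_ln_div_ge (R : realType) (p u : R) :
  0 <= p -> 0 <= u -> (p = 0 -> u = 0) -> u - p <= u * ln (u / p).
Proof.
move=> p0; rewrite le_eqVlt => /predU1P[<- _|u0 pu].
  by rewrite mul0r sub0r oppr_le0.
have {}p0 : 0 < p.
  by rewrite lt_neqAle p0 andbT eq_sym; apply/eqP => /pu eu; rewrite eu ltxx in u0.
have : ln (1 + (p / u - 1)) <= p / u - 1.
  by apply: le_ln1Dx; rewrite ltrBrDl subrr divr_gt0.
rewrite addrC subrK -(invf_div u p) lnV ?posrE ?divr_gt0// => h.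
have := ler_wpM2l (ltW u0) h; rewrite mulrBr mulr1 invf_div mulrCA divff ?gt_eqF// mulr1.
by rewrite mulrN; lra.
Qed.

Lemma rel_entropy_ge0 (R : realType) (p u : R) :
  0 <= p <= 1 -> 0 <= u <= 1 -> (0 <= rel_entropy p u)%E.
Proof.
move=> /andP[p0 p1] /andP[u0 u1]; rewrite /rel_entropy.
case: ifPn => [_|/negbTE pu]; first exact: leey.
have h0 : p = 0 -> u = 0.
  by move=> e; move: pu; rewrite e eqxx /= => /negbFE/eqP.
have h1 : 1 - p = 0 -> 1 - u = 0.
  move=> /subr0_eq e; move: pu; rewrite -e eqxx orbT /= => /negbFE/eqP ->.
  by rewrite subrr.
rewrite lee_fin.
have := @mulr_ln_div_ge _ p u p0 u0 h0.
have := @mulr_ln_div_ge _ (1 - p) (1 - u).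
by rewrite !subr_ge0 => /(_ p1 u1 h1); lra.
Qed.

(** * Integrals of functions with infinite values *)

Section lower_bound.
Import HBNNSimple.

(** The simple function M * 1_E lies below f extended by 0 off D, so it is one of
    those in the supremum defining the integral.  Going through this definition
    avoids a proof that f is measurable. *)
Lemma mul_measure_le_integral d (T : measurableType d) (R : realType)
  (mu : {measure set T -> \bar R}) (D E : set T) (f : T -> \bar R) (M : R) :
  measurable E -> E `<=` D -> 0 <= M ->
  (forall x, D x -> (0 <= f x)%E) -> (forall x, E x -> (M%:E <= f x)%E) ->
  (M%:E * mu E <= \int[mu]_(x in D) f x)%E.
Proof.
move=> mE ED M0 f0 fM; rewrite ge0_integralE//; apply: ereal_sup_ubound.
exists (scale_nnsfun (indic_nnsfun R mE) M0) => /= [x|].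
  rewrite [X in X%:E](_ : _ = M * \1_E x)// indicE /patch.
  have [xE|_] := boolP (x \in E).
    rewrite mulr1 ifT; first by apply: fM; rewrite inE in xE.
    by rewrite inE; apply: ED; rewrite inE in xE.
  by rewrite mulr0; case: ifPn => //; rewrite inE => /f0.
rewrite -(sintegral_indic mu E).
exact: (sintegralrM mu M (indic_nnsfun R mE)).
Qed.

End lower_bound.

Lemma measure0_integral_lty d (T : measurableType d) (R : realType)
  (mu : {measure set T -> \bar R}) (D E : set T) (f : T -> \bar R) :
  measurable E -> E `<=` D -> (forall x, D x -> (0 <= f x)%E) ->
  (forall x, E x -> f x = +oo%E) ->
  (\int[mu]_(x in D) f x < +oo)%E -> mu E = 0%E.
Proof.
move=> mE ED f0 fy Ioo; apply/eqP/negPn/negP => muE0.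
have int_ge (M : R) : 0 <= M -> (M%:E * mu E <= \int[mu]_(x in D) f x)%E.
  by move=> M0; apply: mul_measure_le_integral => // x Ex; rewrite fy// leey.
have muEfin : mu E \is a fin_num.
  rewrite ge0_fin_numE//; apply: (le_lt_trans _ Ioo).
  by rewrite -[leLHS]mul1e; exact: int_ge.
have I0 : (0 <= \int[mu]_(x in D) f x)%E by exact: integral_ge0.
have Ifin : (\int[mu]_(x in D) f x)%E \is a fin_num by rewrite ge0_fin_numE.
have e0 : 0 < fine (mu E).
  by rewrite fine_gt0// lt0e muE0 measure_ge0 -ge0_fin_numE.
(* Any M with M * mu E larger than the integral gives a contradiction. *)
have := int_ge ((fine (\int[mu]_(x in D) f x) + 1) / fine (mu E)).
rewrite divr_ge0 ?addr_ge0 ?fine_ge0// => /(_ isT).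
rewrite -{2}(fineK muEfin) -{2}(fineK Ifin) -EFinM lee_fin divfK ?gt_eqF//.
by rewrite leNgt ltrDl ltr01.
Qed.

(** * The cut distance on the diagonal *)

Lemma measure_preserving_bijection_id (R : realType) :
  @measure_preserving_bijection R id.
Proof.
split; first by split=> // x Ix; exists x.
  by [].
by move=> A mA AI; rewrite setIidr.
Qed.

Lemma d_cut_ge0 (R : realType) (f g : R * R -> R) : (0 <= d_cut f g)%E.
Proof.
apply: ereal_sup_ubound; exists set0, set0; split => //.
by rewrite set0X integral_set0 abse0.
Qed.

Lemma delta_cut_refl (R : realType) (f : graphon R) : delta_cut f f = 0%E.
Proof.
apply/eqP; rewrite eq_le; apply/andP; split; last first.
  by apply: le_ereal_inf_tmp => _ [phi _ <-]; exact: d_cut_ge0.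
apply: le_trans (ereal_inf_lbound _) _.
  by exists id; [exact: measure_preserving_bijection_id|reflexivity].
apply: ge_ereal_sup => _ [S [T [_ _ _ _ ->]]].
rewrite integral0_eq ?abse0// => -[x y] _.
by rewrite /relabel /= subrr.
Qed.

Lemma delta_class_refl (R : realType) (f : graphon R) :
  delta_class (class_of f) (class_of f) = 0%E.
Proof.
apply/eqP; rewrite eq_le; apply/andP; split.
  apply: ereal_inf_lbound; exists f, f.
  by split; rewrite /= delta_cut_refl.
apply: le_ereal_inf_tmp => _ [g [h [_ _ ->]]].
by apply: le_ereal_inf_tmp => _ [phi _ <-]; exact: d_cut_ge0.
Qed.

(** * The two inequalities *)

Lemma measurable_unit_square (R : realType) : measurable (@unit_square R).
Proof. by apply: measurableX; exact: measurable_itv. Qed.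

(** The exceptional set E, where W0 is 0 or 1 and f differs from it, carries an
    infinite integrand, so it is a null set when I f is finite. *)
Lemma rate_I_lty_graphons_Omega (R : realType) (W0 f : graphon R) :
  (rate_I W0 f < +oo)%E -> graphons_Omega W0 f.
Proof.
rewrite /rate_I => Ioo.
have ent0 z : unit_square z -> (0 <= rel_entropy (W0 z) (f z))%E.
  by move=> Dz; apply: rel_entropy_ge0; exact: graphon_range.
have {}Ioo : (\int[@lebesgue2 R]_(z in @unit_square R)
                rel_entropy (W0 z) (f z) < +oo)%E.
  rewrite ltey; apply: contraTneq Ioo => ->.
  by rewrite gt0_muley ?ltxx// lte_fin invr_gt0.
pose E := @unit_square R `&`
  [set z | ((W0 z == 0) || (W0 z == 1)) && (f z != W0 z)].
have mE : measurable E.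
  have mW := graphon_measurable W0; have mf := graphon_measurable f.
  apply: (_ : measurable_fun _ (fun z =>
    ((W0 z == 0) || (W0 z == 1)) && ~~ (f z == W0 z))).
  - apply: measurable_and; last first.
      by apply: measurable_neg; exact: measurable_realfun.measurable_fun_eqr.
    by apply: measurable_or; apply: measurable_realfun.measurable_fun_eqr.
  - exact: measurable_unit_square.
  - by [].
exists E; split => //.
- apply: measure0_integral_lty Ioo => // [z []//|z [_ /=]].
  by rewrite /rel_entropy => ->.
- move=> z /= /not_implyP[[Dz nO] /eqP fW]; split => //=.
  rewrite fW andbT; apply/negPn/negP => /norP[W0z W1z]; apply: nO; split => //.
  have /andP[w0 w1] := graphon_range W0 Dz.
  by rewrite !lt_neqAle eq_sym W0z w0 W1z w1.
Qed.

(** When I f is finite the class of f lies in the domain of J, and f itself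
    competes in each of the infima that define J. *)
Lemma rate_J_class_of_le (R : realType) (W0 f : graphon R) :
  (rate_J W0 (class_of f) <= rate_I W0 f)%E.
Proof.
have [->|] := eqVneq (rate_I W0 f) +oo%E; first exact: leey.
rewrite -ltey => /rate_I_lty_graphons_Omega fO.
rewrite /rate_J; case: asboolP => [_|]; last first.
  by case; exists f => //; exact: delta_class_refl.
apply: ge_ereal_sup => _ [eta /= eta0 <-].
apply: ereal_inf_lbound; exists f => //=.
by rewrite delta_class_refl lee_fin ltW.
Qed.

(** The gap s - t is the tolerance given to the continuity of tau at c: graphons
    near c have tau >= t, so they compete in the infimum on the left. *)
Lemma inf_rate_I_le_rate_J (R : realType) (W0 : graphon R)
  (tau : graphon_class R -> R) (s t : R) (c : graphon_class R) :
  continuous_graph_parameter tau -> t < s -> s <= tau c ->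
  (ereal_inf [set rate_I W0 f |
     f in [set f : graphon R | (t <= tau (class_of f))%R]] <= rate_J W0 c)%E.
Proof.
move=> tauP ts sc; rewrite /rate_J; case: asboolP => _; last exact: leey.
have st : 0 < s - t by rewrite subr_gt0.
have [r r0 hr] := tauP c _ st.
(* Half of r, since J uses closed balls and the continuity of tau open ones. *)
have r20 : 0 < r / 2 by rewrite divr_gt0.
apply: le_trans (ereal_sup_ubound _); last by exists (r / 2).
apply: ereal_inf_le_tmp => _ [h /= ch <-]; exists h => //=.
have /hr : (delta_class c (class_of h) < r%:E)%E.
  by apply: le_lt_trans ch _; rewrite lte_fin; lra.
rewrite ltr_norml => /andP[h1 _]; lra.
Qed.

Theorem lemma3p12 (R : realType) (m : nat) (gamma : 'I_m -> rat)
  (W0 : graphon R) (tau : graphon_class R -> R) (t : R)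
  (m_gt0 : (0 < m)%N)
  (gammaP : simplexQ gamma)
  (W0P : block_graphons gamma W0)
  (tauP : continuous_graph_parameter tau)
  (phi_cont : phi_param tau W0 s @[s --> t] --> phi_param tau W0 t) :
  phi_param tau W0 t =
    ereal_inf [set rate_I W0 f |
      f in [set f : graphon R | t <= tau (class_of f)]].
Proof.
apply/eqP; rewrite eq_le; apply/andP; split.
  apply: le_ereal_inf_tmp => _ [f /= tf <-].
  apply: le_trans (rate_J_class_of_le _ W0 f).
  by apply: ereal_inf_lbound; exists (class_of f).
(* It suffices to compare with phi s for s > t close to t. *)
apply: (cvge_to_ge (cvg_at_right_filter phi_cont)).
near=> s; apply: le_ereal_inf_tmp => _ [c /= sc <-].
exact: inf_rate_I_le_rate_J sc.
Unshelve. all: by end_near.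
Qed.
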